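(* For $\tau\ge0$ let $\mu_\tau$ be the compactly supported probability measure on $[0,1]$ with $S$-transform $S_{\mu_\tau}(z)=\exp\left(\frac{\tau}{1+z}\right)$, and let $m_p(\tau)=\int_0^1 x^p\,d\mu_\tau(x)$. Then for every integer $p\ge1$, $$m_p(\tau)=e^{-p\tau}\sum_{k=0}^{p-1}\left(1-\frac kp\right)\frac{(p\tau)^k}{k!}.$$ Equivalently, $m_p(\tau)=e^{-p\tau}\dfrac{G_p(\tau)}{(p-1)!}$, where $$G_p(\tau)=(p-1)!\sum_{k=0}^{p-1}\left(1-\frac kp\right)\frac{(p\tau)^k}{k!}.$$
   Context: The $S$-transform of a compactly supported probability measure $\mu\neq\delta_0$ on $[0,\infty)$ is defined near $0$ by $S_\mu(w)=\frac{1+w}{w}\psi_\mu^{-1}(w)$, where $\psi_\mu(z)=\sum_{p\ge1}z^p\int x^p\,d\mu(x)$ and $\psi_\mu^{-1}$ is the compositional inverse near $0$. For every $\tau\ge0$ there is exactly one compactly supported probability measure $\mu_\tau$ on $[0,1]$ with the stated $S$-transform (with $\mu_0=\delta_1$); for $\tau>0$ it is the weak limit as $n\to\infty$ of the free multiplicative convolution powers $\nu_{\tau/n}^{\boxtimes n}$, where $\nu_c=(1-c)\delta_1+c\delta_0$. Convention: $0^0=1$. *)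

(* Defs.v *)
From HB Require Import structures.
From mathcomp Require Import all_boot all_order all_algebra.
From mathcomp Require Import all_classical all_reals all_analysis.

Set Implicit Arguments.
Unset Strict Implicit.
Unset Printing Implicit Defensive.

Import Order.TTheory GRing.Theory Num.Theory.
Import numFieldNormedType.Exports.

Local Open Scope classical_set_scope.
Local Open Scope ring_scope.

(* psi_mu(z) = sum_{p >= 1} z^p \int x^p dmu(x).  For z outside the interval of
   convergence the value is irrelevant: psi is only used near 0. *)
Definition psi (R : realType) (mu : probability (measurableTypeR R) R)
    (z : R) : R :=
  limn (fun n : nat => \sum_(1 <= p < n) z ^+ p * \int[mu]_x (x ^+ p)).

(* [g] is a compositional inverse of [f] near 0.  The continuity of [g] at 0
   makes both compositions local statements, so that the germ of [g] at 0 is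
   uniquely determined by that of [f]. *)
Definition inverse_near0 (R : realType) (f g : R -> R) : Prop :=
  [/\ f 0 = 0, g 0 = 0, {for 0, continuous f} & {for 0, continuous g}]
  /\ (\forall z \near 0, g (f z) = z) /\ (\forall w \near 0, f (g w) = w).

(* The S-transform is a germ at 0, so it is a relation between [mu] and a
   function [S].  The neighbourhood of 0 is punctured because the formula is
   singular at w = 0, where S is extended by continuity.  Restricting w to the
   reals loses nothing: the moments are real, and an analytic germ at 0 is
   determined by its values at real points.  The relation is meant for [mu] of
   compact support in [0, oo[; no S is related to mu = delta_0, since then
   psi = 0 has no inverse. *)
Definition is_S_transform (R : realType)
    (mu : probability (measurableTypeR R) R) (S : R -> R) : Prop :=
  exists2 chi : R -> R, inverse_near0 (psi mu) chi
    & \forall w \near 0^', S w = (1 + w) / w * chi w.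

Definition G (R : realType) (p : nat) (tau : R) : R :=
  (p.-1)`!%:R *
  \sum_(0 <= k < p) (1 - k%:R / p%:R) * ((p%:R * tau) ^+ k / k`!%:R).

(* Main.v *)
Require Import Defs.
From HB Require Import structures.
From mathcomp Require Import all_boot all_order all_algebra.
From mathcomp Require Import all_classical all_reals all_analysis.
From mathcomp Require Import measurable_realfun ring lra.
Import Order.TTheory GRing.Theory Num.Theory.
Import numFieldNormedType.Exports.
Local Open Scope classical_set_scope.
Local Open Scope ring_scope.

(** Put v = w / (1 + w).  Then 1 / (1 + w) = 1 - v, and the given S-transform
    says that the inverse of psi takes w to v e^(tau (1 - v)).  Substituting
    this in psi (chi w) = w and writing b_p = e^(p tau) m_p gives, for small
    v > 0 (lemma [S_transform_functional_eq]),

      sum_(p >= 1) b_p v^p e^(- p tau v) = v / (1 - v).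

    Expanding the exponentials and comparing the coefficients of v^n yields
    (lemma [moment_kernel])

      sum_(1 <= p <= n) b_p (- p tau)^(n - p) / (n - p)! = 1    for n >= 1,

    a linear system with unit triangular matrix, hence with only one solution
    (lemma [unitriangular_unique]).  So it is enough that the claimed values of
    b_p solve the system (lemma [tree_coef_kernel]).  After an exchange of summations this is the vanishing
    of the N-th finite difference of a polynomial of degree below N (lemma
    [alternating_binomial_sum0]).

    To compare the coefficients, everything is truncated at order N, with errors
    bounded by a multiple of v^N as v -> 0+; a polynomial bounded by a multiple
    of v^N near 0+ has no coefficient below N (lemma [poly_flat_coef0]).  The tail of psi is controlled because the moments lie
    in [0, 1]. *)

(** * Binomial sums and the triangular system *)

(** An N-th finite difference of x^d, with d < N.  The induction on d uses
    (a + i)^(d + 1) = a (a + i)^d + i (a + i)^d and i C(N, i) = N C(N - 1, i - 1),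
    which shifts a by one in the second sum. *)
Lemma alternating_binomial_sum0 (K : comRingType) (d N : nat) (a : K) :
  (d < N)%N ->
  \sum_(0 <= i < N.+1) (-1) ^+ i * 'C(N, i)%:R * (a + i%:R) ^+ d = 0.
Proof.
elim: d N a => [|d IHd] [//|N] a ltdN.
  have := exprBn_comm N.+1 (commr1 (1 : K)); rewrite subrr expr0n /= big_mkord => E.
  rewrite [RHS]E; apply: eq_bigr => i _.
  by rewrite !expr1n !expr0 !mulr1 mulr_natr.
transitivity (a * (\sum_(0 <= i < N.+2) (-1) ^+ i * 'C(N.+1, i)%:R * (a + i%:R) ^+ d)
  - N.+1%:R * \sum_(0 <= i < N.+1) (-1) ^+ i * 'C(N, i)%:R * ((a + 1) + i%:R) ^+ d).
  have -> : N.+1%:R * (\sum_(0 <= i < N.+1) (-1) ^+ i * 'C(N, i)%:R * ((a + 1) + i%:R) ^+ d)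
    = - \sum_(0 <= i < N.+2) i%:R * ((-1) ^+ i * 'C(N.+1, i)%:R * (a + i%:R) ^+ d).
    rewrite [in RHS]big_nat_recl //= mul0r add0r mulr_sumr -sumrN.
    apply: eq_bigr => i _.
    have E : N.+1%:R * 'C(N, i)%:R = i.+1%:R * 'C(N.+1, i.+1)%:R :> K.
      by rewrite -!natrM mul_bin_diag.
    transitivity ((-1) ^+ i * (N.+1%:R * 'C(N, i)%:R) * (a + 1 + i%:R) ^+ d).
      by ring.
    have -> : a + 1 + i%:R = a + i.+1%:R by rewrite -natr1; ring.
    by rewrite E exprS; ring.
  rewrite opprK mulr_sumr -big_split /=.
  by apply: eq_bigr => i _; rewrite exprS; ring.
by rewrite !IHd ?mulr0 ?subr0 // ltnW.
Qed.

(** The claimed value of e^(p tau) m_p.  It is the coefficient of u^p in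
    v / (1 - v), where v is the power series solution of v = u e^(tau v), a
    rescaled tree function. *)
Definition tree_coef {R : realFieldType} (tau : R) (p : nat) : R :=
  \sum_(0 <= k < p) (1 - k%:R / p%:R) * ((p%:R * tau) ^+ k / k`!%:R).

(** With j = p - k, the terms for a given j add up to a multiple of the sum of
    (-1)^(n - p) C(n - j, p - j) p^(n - j - 1) over j <= p <= n.  For j < n this
    is a finite difference of order n - j of a polynomial of degree n - j - 1;
    only j = n remains. *)
Lemma tree_coef_kernel (R : realFieldType) (tau : R) (n : nat) : (0 < n)%N ->
  \sum_(1 <= p < n.+1) tree_coef tau p * ((- (p%:R * tau)) ^+ (n - p) / (n - p)`!%:R) = 1.
Proof.
move=> n0.
have rev p : (0 < p)%N -> tree_coef tau p =
    \sum_(1 <= j < p.+1) j%:R / p%:R * ((p%:R * tau) ^+ (p - j) / (p - j)`!%:R).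
  move=> p0; rewrite big_add1 /= big_nat_rev /= add0n.
  apply: eq_big_nat => k /andP[_ kp].
  rewrite subnSK // subKn 1?ltnW // natrB 1?ltnW //; congr (_ * _).
  rewrite mulrBl divff //.
  by rewrite pnatr_eq0 -lt0n.
(* Exchange the sums over p and j <= p. *)
transitivity (\sum_(1 <= j < n.+1) \sum_(j <= p < n.+1)
   j%:R / p%:R * ((p%:R * tau) ^+ (p - j) / (p - j)`!%:R) *
     ((- (p%:R * tau)) ^+ (n - p) / (n - p)`!%:R)).
  transitivity (\sum_(1 <= p < n.+1) \sum_(1 <= j < n.+1 | (j <= p)%N)
     j%:R / p%:R * ((p%:R * tau) ^+ (p - j) / (p - j)`!%:R) *
     ((- (p%:R * tau)) ^+ (n - p) / (n - p)`!%:R)).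
    apply: eq_big_nat => p /andP[p0 pn].
    by rewrite rev // mulr_suml (big_nat_widen _ _ n.+1).
  rewrite (exchange_big_dep_nat xpredT) //=.
  by apply: eq_big_nat => j /andP[j0 _]; rewrite [RHS](big_nat_widenl _ 1).
have diag j : (0 < j < n)%N -> \sum_(j <= p < n.+1)
   j%:R / p%:R * ((p%:R * tau) ^+ (p - j) / (p - j)`!%:R) *
     ((- (p%:R * tau)) ^+ (n - p) / (n - p)`!%:R) = 0.
  case/andP=> j0 jn.
  have [N Nn] : exists N, n = (j + N.+1)%N.
    by exists (n - j.+1)%N; rewrite addnS -addSn subnKC.
  rewrite -{1}[j]add0n big_addn Nn.
  have -> : ((j + N.+1).+1 - j = N.+2)%N by rewrite -addnS addKn.
  transitivity (j%:R * (- tau) ^+ N.+1 / N.+1`!%:R *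
    \sum_(0 <= i < N.+2) (-1) ^+ i * 'C(N.+1, i)%:R * (j%:R + i%:R) ^+ N); last first.
    by rewrite alternating_binomial_sum0 ?mulr0.
  rewrite mulr_sumr; apply: eq_big_nat => i /andP[_ iN].
  have -> : (j + N.+1 - (i + j) = N.+1 - i)%N by rewrite [(i + j)%N]addnC subnDl.
  rewrite addnK -(@bin_fact N.+1 i iN) !natrM.
  rewrite -natrD [(j + i)%N]addnC.
  set x := (i + j)%:R : R.
  have x0 : x != 0 by rewrite pnatr_eq0 -lt0n addn_gt0 j0 orbT.
  have f0 k : k`!%:R != 0 :> R by rewrite pnatr_eq0 -lt0n fact_gt0.
  (* The factor 1 / p = 1 / x lowers the degree from N + 1 to N, which is what
     makes the finite difference of order N + 1 vanish. *)
  have e1 : x ^+ N = x ^+ i * x ^+ (N.+1 - i) / x.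
    by rewrite -exprD subnKC // exprS mulrAC divff ?mul1r.
  have e2 : (- tau) ^+ N.+1 = (-1) ^+ i * tau ^+ i * ((-1) ^+ (N.+1 - i) * tau ^+ (N.+1 - i)).
    by rewrite -!exprMn !mulN1r -exprD subnKC.
  have e3 : (-1) ^+ i * (-1) ^+ i = 1 :> R by rewrite -exprMn mulrNN mulr1 expr1n.
  have b0 : 'C(N.+1, i)%:R != 0 :> R by rewrite pnatr_eq0 -lt0n bin_gt0.
  rewrite e1 e2 -[- (x * tau)]mulN1r !exprMn.
  (* The square of the sign is put on the left, where field cannot find it. *)
  set L := (LHS); rewrite -[LHS]mul1r -[X in X * _]e3 /L.
  by clearbody x; field; rewrite x0 !f0 b0.
rewrite big_nat_recr //= big_nat1 !subnn !expr0 fact0 divr1 !mulr1 divff ?pnatr_eq0 -?lt0n //.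
by rewrite big_nat_cond big1 ?add0r // => j; rewrite andbT; apply: diag.
Qed.

Lemma unitriangular_unique (K : pzRingType) (L : nat -> nat -> K) (x y : nat -> K) :
  (forall n, L n n = 1) ->
  (forall n, (0 < n)%N ->
     \sum_(1 <= p < n.+1) x p * L n p = \sum_(1 <= p < n.+1) y p * L n p) ->
  forall n, (0 < n)%N -> x n = y n.
Proof.
move=> L1 eqL n; have [k] := ubnP n; elim: k n => // k IH n ltnk n0.
have := eqL n n0; rewrite !big_nat_recr //= L1 !mulr1.
suff -> : \sum_(1 <= p < n) x p * L n p = \sum_(1 <= p < n) y p * L n p.
  by move/addrI.
apply: eq_big_nat => p /andP[p0 pn]; rewrite IH //.
exact: leq_trans pn ltnk.
Qed.

(** * Comparison of coefficients near 0+ *)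

(** The constant coefficient vanishes by letting v -> 0+; then a factor v can be
    cancelled from the estimate. *)
Lemma poly_flat_coef0 (R : realType) (N : nat) (P : {poly R}) (C : R) :
  (\forall v \near 0^'+, `|P.[v]| <= C * v ^+ N) ->
  forall k, (k < N)%N -> P`_k = 0.
Proof.
elim: N P => // N IH; elim/poly_ind => [|Q c _] flatP; first by move=> k; rewrite coef0.
have c0 : c = 0.
  pose h : {poly R} := C *: 'X^(N.+1).
  have cv (p : {poly R}) : p.[v] @[v --> 0^'+] --> p.[0].
    by apply: cvg_at_right_filter; exact: continuous_horner.
  have le0 : h.[0] - `|(Q * 'X + c%:P).[0]| >= 0.
    apply: (@cvgr_to_ge _ (0^'+) _ R (fun v => h.[v] - `|(Q * 'X + c%:P).[v]|)).
      by apply: cvgB; [exact: cv | apply: cvg_norm; exact: cv].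
    near=> v; rewrite subr_ge0 /h hornerZ hornerXn; near: v; exact: flatP.
  move: le0; rewrite /h !hornerE expr0n /= !mulr0 !add0r oppr_ge0 normr_le0.
  by move/eqP.
have flatQ : \forall v \near 0^'+, `|Q.[v]| <= C * v ^+ N.
  near=> v; have v0 : 0 < v by near: v; exact: nbhs_right_gt.
  rewrite -(ler_pM2r v0) -[X in _ * X <= _](gtr0_norm v0) -normrM -mulrA -exprSr.
  have : `|(Q * 'X + c%:P).[v]| <= C * v ^+ N.+1 by near: v; exact: flatP.
  by rewrite c0 addr0 hornerMX.
case=> [|k] kN; rewrite c0 addr0 coefMX //=.
exact: IH flatQ _ kN.
Unshelve. all: by end_near.
Qed.

Definition exp_trunc {R : realType} (n : nat) (a : R) : {poly R} :=
  \poly_(k < n) (a ^+ k / k`!%:R).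

Lemma deriv_exp_trunc {R : realType} n (a : R) :
  (exp_trunc n.+1 a)^`() = a *: exp_trunc n a.
Proof.
apply/polyP => k; rewrite coef_deriv coefZ !coef_poly ltnS.
case: ifP => kn; last by rewrite mul0rn mulr0.
have k1 : k.+1%:R != 0 :> R by rewrite pnatr_eq0.
by rewrite factS natrM exprS -[LHS]mulr_natr invfM mulrA mulrAC mulfVK // -mulrA.
Qed.

(** For n + 1, the remainder vanishes at 0 and its derivative is - a times the
    remainder for n, so the bound follows by the mean value theorem.  The
    factor 1 / n! of the sharp bound is dropped. *)
Lemma expRN_trunc_le (R : realType) (a : R) n (y : R) : 0 <= a -> 0 <= y ->
  `|expR (- a * y) - (exp_trunc n (- a)).[y]| <= (a * y) ^+ n.
Proof.
move=> a0; elim: n y => [|n IH] y y0.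
  rewrite /exp_trunc poly_def big_ord0 horner0 subr0 expr0 ger0_norm ?expR_ge0 //.
  by rewrite -expR0 ler_expR mulNr oppr_le0 mulr_ge0.
pose f t := expR (- a * t) - (exp_trunc n.+1 (- a)).[t].
pose df t := - a * (expR (- a * t) - (exp_trunc n (- a)).[t]).
have fder (t : R) : is_derive t 1 f (df t).
  have d0 : is_derive t 1 ( *%R (- a)) (- a).
    by apply: is_derive_eq; exact: mulr1.
  have d1 : is_derive t 1 (fun t => expR (- a * t)) (- a * expR (- a * t)).
    apply: (@is_derive_eq _ _ _ _ _ _ _ _ (is_derive1_comp _ d0)).
    exact: mulrC.
  apply: is_derive_eq.
  by rewrite deriv_exp_trunc hornerZ /df mulrBr.
have fcont : {within `[0, y], continuous f}.
  apply: derivable_within_continuous => t _.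
  exact: (@ex_derive _ _ _ _ _ _ _ (fder t)).
have [c] := MVT_segment y0 (fun t _ => fder t) fcont.
rewrite in_itv /= => /andP[c0 cy].
have -> : f 0 = 0.
  rewrite /f mulr0 expR0 /exp_trunc horner_poly big_ord_recl /= expr0 fact0 divr1 mulr1.
  by rewrite big1 ?addr0 ?subrr // => i _; rewrite expr0n mulr0.
rewrite subr0 /f => ->; rewrite /df subr0 !normrM normrN (ger0_norm a0) (ger0_norm y0).
rewrite mulrAC exprSr mulrC.
rewrite ler_wpM2r ?mulr_ge0 // (le_trans (IH _ c0)) //.
by rewrite lerXn2r ?nnegrE ?mulr_ge0 ?ler_wpM2l.
Qed.

(** The tail is dominated by the geometric series of ratio z <= 1/2.  The
    partial sums increase, so the limit exists and inherits the bound. *)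
Lemma power_series_tail_le (R : realType) (m : nat -> R) (z : R) (N : nat) :
  (forall p, 0 <= m p <= 1) -> 0 <= z <= 2^-1 -> (0 < N)%N ->
  `|limn (fun n : nat => \sum_(1 <= p < n) z ^+ p * m p)
     - \sum_(1 <= p < N) z ^+ p * m p| <= 2 * z ^+ N.
Proof.
move=> m01 /andP[z0 z12] N0.
set s := (fun n : nat => \sum_(1 <= p < n) z ^+ p * m p).
have t0 p : 0 <= z ^+ p * m p.
  by rewrite mulr_ge0 ?exprn_ge0 //; case/andP: (m01 p).
have smono : {homo s : k l / (k <= l)%N >-> k <= l}.
  apply/nondecreasing_seqP => -[|n]; first by rewrite /s !big_geq.
  by rewrite /s [leRHS]big_nat_recr //= lerDl.
(* The subtracted term 2 z^n lets the bound survive the induction on n. *)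
have sN n : (N <= n)%N -> s n <= s N + 2 * (z ^+ N - z ^+ n).
  elim: n => [|n IH]; first by rewrite leqNgt N0.
  rewrite leq_eqVlt => /predU1P[<-|]; first by rewrite subrr mulr0 addr0.
  rewrite ltnS => Nn; have n0 := leq_trans N0 Nn.
  rewrite /s big_nat_recr //=; have := IH Nn; rewrite -/(s n) -/(s N).
  have : z ^+ n * m n <= z ^+ n by rewrite ler_piMr ?exprn_ge0 //; case/andP: (m01 n).
  have : z ^+ n.+1 <= z ^+ n * 2^-1 by rewrite exprSr ler_wpM2l ?exprn_ge0.
  lra.
have sub n : s n <= s N + 2 * z ^+ N.
  have [/sN|/ltnW/smono] := leqP N n; have := exprn_ge0 n z0; have := exprn_ge0 N z0; lra.
have scv : cvgn s.
  by apply: nondecreasing_is_cvgn => //; exists (s N + 2 * z ^+ N) => _ [n _ <-].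
have lo : s N <= limn s by exact: nondecreasing_cvgn_le.
have hi : limn s <= s N + 2 * z ^+ N by apply: limr_le => //; near=> n; exact: sub.
by rewrite -/(s N) ger0_norm ?subr_ge0 // lerBlDl.
Unshelve. all: by end_near.
Qed.

(** * Moments of a probability measure on [0, 1] *)

(** The function agrees almost everywhere with its restriction to A.  This form
    covers the odd powers of x, which change sign outside [0, 1]. *)
Lemma Rintegral_probability1 d (T : measurableType d) (R : realType)
    (mu : probability T R) (A : set T) (f : T -> R) :
  measurable A -> mu A = 1%E -> measurable_fun setT f ->
  \int[mu]_x f x = \int[mu]_(x in A) f x.
Proof.
move=> mA muA mf; rewrite [RHS]Rintegral_mkcond /Rintegral; congr fine.
apply: ae_eq_integral => //.
- exact/measurable_EFinP.
- apply/measurable_EFinP; apply/(measurable_restrict _ mA) => //.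
  by rewrite setTI; apply: measurable_funS mf.
exists (~` A); split; first exact: measurableC.
  have /= -> := probability_setC mu mA.
  by rewrite [X in (1 - X)%E]muA subee.
by move=> x /= H Ax; apply: H => _; rewrite patchE mem_set.
Qed.

Lemma moment_itv01 (R : realType) (mu : probability (measurableTypeR R) R) p :
  mu `[0%R, 1%R]%classic = 1%E -> 0 <= \int[mu]_(x in `[0, 1]) (x ^+ p) <= 1.
Proof.
move=> mu1; have mI : measurable (`[0, 1]%classic : set (measurableTypeR R)).
  exact: measurable_itv.
have mfin : (mu `[0%R, 1%R]%classic < +oo)%E by rewrite mu1 ltry.
apply/andP; split.
  apply: Rintegral_ge0 => x /=; rewrite in_itv /= => /andP[x0 _]; exact: exprn_ge0.
apply: (@le_trans _ _ (\int[mu]_(x in `[0, 1]) 1)); last first.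
  by rewrite Rintegral_cst // [X in fine X]mu1 mulr1.
apply: le_Rintegral => //.
- apply: measurable_bounded_integrable => //.
  exists 1; split => // M M1 x /=; rewrite in_itv /= => /andP[x0 x1].
  by rewrite ger0_norm ?exprn_ge0 // (le_trans _ (ltW M1)) // exprn_ile1.
- by apply: measurable_bounded_integrable => //; exists 1; split => // M M1 x _; rewrite normr1 ltW.
- by move=> x /=; rewrite in_itv /= => /andP[x0 x1]; rewrite exprn_ile1.
Qed.

(** * From the S-transform to the triangular system *)

(** The relation psi (chi w) = w at w = v / (1 - v), with chi w computed from the
    S-transform. *)
Lemma S_transform_functional_eq (R : realType) (tau : R)
    (mu : probability (measurableTypeR R) R) :
  is_S_transform mu (fun z : R => expR (tau / (1 + z))) ->
  \forall v \near 0^'+, psi mu (v * expR (tau * (1 - v))) = v / (1 - v).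
Proof.
case=> chi [_ [_ psiK]] Schi.
have [e /= e0 He] : exists2 e : R, 0 < e & forall w : R, 0 < w < e ->
    psi mu (w / (1 + w) * expR (tau / (1 + w))) = w.
  move: psiK => /nbhs_normP[e1 /= e10 H1].
  move: Schi => /nbhs_normP[e2 /= e20 H2].
  exists (Num.min e1 e2); first by rewrite lt_min e10.
  move=> w /andP[w0]; rewrite lt_min => /andP[w1 w2].
  have w'0 : w != 0 by rewrite gt_eqF.
  have w1'0 : 1 + w != 0 by rewrite gt_eqF // addr_gt0.
  have nw (d : R) : w < d -> `|0 - w| < d by rewrite sub0r normrN gtr0_norm.
  rewrite (H2 w (nw _ w2) w'0).
  have -> : w / (1 + w) * ((1 + w) / w * chi w) = chi w.
    by field; rewrite w1'0 w'0.
  exact: (H1 w (nw _ w1)).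
near=> v.
have v0 : 0 < v by near: v; exact: nbhs_right_gt.
have v2 : v < 2^-1 by near: v; apply: nbhs_right_lt; lra.
have ve : v < e / 2 by near: v; apply: nbhs_right_lt; rewrite divr_gt0.
have v1 : 0 < 1 - v by lra.
have v1' : 1 - v != 0 by rewrite gt_eqF.
have -> : v * expR (tau * (1 - v))
    = v / (1 - v) / (1 + v / (1 - v)) * expR (tau / (1 + v / (1 - v))).
  have -> : 1 + v / (1 - v) = (1 - v)^-1 by field.
  by rewrite invrK mulfVK.
apply: He; rewrite divr_gt0 //= ltr_pdivrMr //.
have : e * v < e * 2^-1 by rewrite ltr_pM2l.
lra.
Unshelve. all: by end_near.
Qed.

Lemma geometric_trunc_le (R : realType) (v : R) (N : nat) : 0 < v < 2^-1 ->
  `|v / (1 - v) - \sum_(1 <= k < N.+1) v ^+ k| <= 2 * v ^+ N.+1.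
Proof.
case/andP=> v0 v2.
have v1 : 0 < 1 - v by lra.
have -> : v / (1 - v) - \sum_(1 <= k < N.+1) v ^+ k = v ^+ N.+1 / (1 - v).
  elim: N => [|N IH]; first by rewrite big_geq // subr0 expr1.
  rewrite big_nat_recr //= opprD addrA IH [in RHS]exprS; field.
  by rewrite gt_eqF.
have vN0 : 0 <= v ^+ N.+1 by rewrite exprn_ge0 // ltW.
rewrite ger0_norm; last by rewrite divr_ge0 // ltW.
by rewrite ler_pdivrMr // mulrAC ler_peMl //; lra.
Qed.

(** P below is the difference of the two sides of the functional equation,
    truncated at order n + 1.  It is bounded by C v^(n + 1) near 0+, where the
    three terms of C bound the errors from truncating the exponentials, psi and
    the geometric series; so its coefficient of v^n is zero. *)
Lemma moment_kernel (R : realType) (tau : R)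
    (mu : probability (measurableTypeR R) R) (m : nat -> R) : 0 <= tau ->
  (forall p, 0 <= m p <= 1) ->
  (forall z, psi mu z = limn (fun n : nat => \sum_(1 <= p < n) z ^+ p * m p)) ->
  is_S_transform mu (fun z : R => expR (tau / (1 + z))) ->
  forall n, (0 < n)%N ->
  \sum_(1 <= p < n.+1) m p * expR (p%:R * tau)
     * ((- (p%:R * tau)) ^+ (n - p) / (n - p)`!%:R) = 1.
Proof.
move=> tau0 m01 psiE hS n n0.
pose b p := m p * expR (p%:R * tau).
pose P : {poly R} :=
  \sum_(1 <= p < n.+1) b p *: ('X^p * exp_trunc n.+1 (- (p%:R * tau)))
  - \sum_(1 <= k < n.+1) 'X^k.
pose C := \sum_(1 <= p < n.+1) b p * (p%:R * tau) ^+ n.+1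
  + 2 * expR tau ^+ n.+1 + 2.
have b0 p : 0 <= b p by rewrite mulr_ge0 ?expR_ge0 //; case/andP: (m01 p).
have flatP : \forall v \near 0^'+, `|P.[v]| <= C * v ^+ n.+1.
  have feq := S_transform_functional_eq _ _ _ hS.
  near=> v.
  have v0 : 0 < v by near: v; exact: nbhs_right_gt.
  have v2 : v < 2^-1 by near: v; apply: nbhs_right_lt; lra.
  (* This ensures z <= 1/2, as the bound on the tail of psi requires. *)
  have ve : v < (2 * expR tau)^-1.
    by near: v; apply: nbhs_right_lt; rewrite invr_gt0 mulr_gt0 ?expR_gt0.
  have fz : psi mu (v * expR (tau * (1 - v))) = v / (1 - v) by near: v; exact: feq.
  set z := v * expR (tau * (1 - v)) in fz.
  have zle : z <= expR tau * v.
    rewrite /z mulrC ler_pM2r // ler_expR mulrBr mulr1 lerBlDr lerDl.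
    by rewrite mulr_ge0 // ltW.
  have z0 : 0 <= z by rewrite mulr_ge0 ?expR_ge0 ?ltW.
  have z2 : z <= 2^-1.
    apply: (le_trans zle); move: ve; rewrite invfM ltr_pdivlMr ?expR_gt0 //.
    by rewrite mulrC; exact: ltW.
  have zX p : z ^+ p = v ^+ p * expR (p%:R * tau) * expR (- (p%:R * tau) * v).
    rewrite exprMn -expRM_natl -mulrA -expRD; congr (_ * expR _); ring.
  have tail := power_series_tail_le R m z n.+1 m01 _ _.
  have {tail}tail : `|v / (1 - v) - \sum_(1 <= p < n.+1) z ^+ p * m p| <= 2 * z ^+ n.+1.
    by rewrite -fz psiE tail // z0.
  have zN : z ^+ n.+1 <= expR tau ^+ n.+1 * v ^+ n.+1.
    by rewrite -exprMn lerXn2r // nnegrE mulr_ge0 ?expR_ge0 // ltW.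
  have geo := geometric_trunc_le R v n _; rewrite v0 v2 in geo; have {}geo := geo isT.
  have ex : `|\sum_(1 <= p < n.+1) z ^+ p * m p -
      (\sum_(1 <= p < n.+1) b p *: ('X^p * exp_trunc n.+1 (- (p%:R * tau)))).[v]|
      <= (\sum_(1 <= p < n.+1) b p * (p%:R * tau) ^+ n.+1) * v ^+ n.+1.
    rewrite horner_sum -sumrB mulr_suml (le_trans (ler_norm_sum _ _ _)) //.
    apply: ler_sum => p _; rewrite hornerZ hornerM hornerXn zX.
    have -> : v ^+ p * expR (p%:R * tau) * expR (- (p%:R * tau) * v) * m p
       - b p * (v ^+ p * (exp_trunc n.+1 (- (p%:R * tau))).[v])
      = b p * (v ^+ p * (expR (- (p%:R * tau) * v) - (exp_trunc n.+1 (- (p%:R * tau))).[v])).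
      by rewrite /b; ring.
    rewrite normrM (ger0_norm (b0 p)) -mulrA ler_wpM2l // normrM -exprMn.
    rewrite -[leRHS]mul1r ler_pM //; last first.
      by apply: expRN_trunc_le; [rewrite mulr_ge0 | exact: ltW].
    have v0' := ltW v0; rewrite ger0_norm ?exprn_ge0 // exprn_ile1 //; lra.
  have -> : P.[v] = (v / (1 - v) - \sum_(1 <= k < n.+1) v ^+ k)
    - (v / (1 - v) - \sum_(1 <= p < n.+1) z ^+ p * m p)
    - (\sum_(1 <= p < n.+1) z ^+ p * m p -
      (\sum_(1 <= p < n.+1) b p *: ('X^p * exp_trunc n.+1 (- (p%:R * tau)))).[v]).
    have <- : (\sum_(1 <= k < n.+1) 'X^k).[v] = \sum_(1 <= k < n.+1) v ^+ k.
      by rewrite horner_sum; apply: eq_bigr => k _; rewrite hornerXn.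
    rewrite /P hornerD hornerN.
    by ring.
  rewrite (le_trans (ler_normB _ _)) // /C !mulrDl.
  have := ler_normB (v / (1 - v) - \sum_(1 <= k < n.+1) v ^+ k)
     (v / (1 - v) - \sum_(1 <= p < n.+1) z ^+ p * m p).
  lra.
have := poly_flat_coef0 _ _ _ _ flatP n (ltnSn n).
rewrite /P coefB !coef_sum => /eqP; rewrite subr_eq0 => /eqP E.
transitivity (\sum_(1 <= k < n.+1) ('X^k : {poly R})`_n); last first.
  rewrite big_nat_recr //= coefXn eqxx big_nat_cond big1 ?add0r // => k.
  by rewrite andbT => /andP[_ kn]; rewrite coefXn gtn_eqF.
rewrite -E; apply: eq_big_nat => p /andP[_ pn].
rewrite coefZ coefXnM ltnNge -ltnS pn /= coef_poly ifT //.
by rewrite ltnS leq_subr.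
Unshelve. all: by end_near.
Qed.

Theorem mainTheorem3 (R : realType) (tau : R) (htau : 0 <= tau)
    (mu : probability (measurableTypeR R) R)
    (hsupp : mu `[0%R, 1%R]%classic = 1%E)
    (hS : is_S_transform mu (fun z : R => expR (tau / (1 + z))))
    (p : nat) (hp : (1 <= p)%N) :
  \int[mu]_(x in `[0%R, 1%R]) (x ^+ p) =
    expR (- (p%:R * tau)) *
    \sum_(0 <= k < p) (1 - k%:R / p%:R) * ((p%:R * tau) ^+ k / k`!%:R)
  /\
  \int[mu]_(x in `[0%R, 1%R]) (x ^+ p) =
    expR (- (p%:R * tau)) * (G p tau / (p.-1)`!%:R).
Proof.
pose m k : R := \int[mu]_(x in `[0%R, 1%R]) (x ^+ k).
have psiE z : psi mu z = limn (fun n : nat => \sum_(1 <= k < n) z ^+ k * m k).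
  rewrite /psi; congr (limn _); apply/funext => n; apply: eq_bigr => k _.
  congr (_ * _); apply: Rintegral_probability1 => //; exact: measurable_itv.
have kernel := moment_kernel _ _ _ m htau (fun k => moment_itv01 _ _ k hsupp) psiE hS.
have scaled_moment : m p * expR (p%:R * tau) = tree_coef tau p.
  apply: (unitriangular_unique R
    (fun n k => (- (k%:R * tau)) ^+ (n - k) / (n - k)`!%:R)
    (fun k => m k * expR (k%:R * tau)) (tree_coef tau)) => // [n|n n0].
    by rewrite subnn expr0 fact0 divr1.
  by rewrite kernel // tree_coef_kernel.
have moment : m p = expR (- (p%:R * tau)) * tree_coef tau p.
  by rewrite -scaled_moment mulrCA -expRD addNr expR0 mulr1.
have fact_neq0 : (p.-1)`!%:R != 0 :> R by rewrite pnatr_eq0 -lt0n fact_gt0.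
by split; rewrite -/(m p) moment // /G mulrAC divff // mul1r.
Qed.
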